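(* Let $\mathbf{V}$ be a finite set with $|\mathbf{V}|\ge 2$, let $Q$ be the generator of an irreducible, reversible, continuous-time Markov chain on $\mathbf{V}$ with stationary distribution $\pi$, and let $(X_t)_{t\ge0}$ denote a realization of this chain, started from $\pi$ under $\mathbb{P}_\pi$. Then there exist $v\in\mathbf{V}$ and a quasistationary distribution $\mathsf{q}_v$ for $\mathbf{V}\setminus\{v\}$ such that for every deterministic càdlàg path $h:[0,+\infty)\to\mathbf{V}$ and every $t\ge0$, $$\mathbb{P}_\pi\left(\forall\,0\le s\le t,\ X_s\ne h_s\right)\le\mathbb{P}_{\mathsf{q}_v}(H_v>t)=\exp\left(-\frac{t}{\mathbb{E}_{\mathsf{q}_v}[H_v]}\right).$$
   Context: Markov chain: $Q$ is given by transition rates $q(x,y)\ge 0$ for distinct $x,y\in\mathbf{V}$, acting on $f:\mathbf{V}\to\mathbb{R}$ by $(Qf)(x)=\sum_{y\ne x}q(x,y)(f(x)-f(y))$; the transition probabilities are $\mathbb{P}_x(X_t=y)=$ the $(x,y)$ entry of $e^{-tQ}$, and trajectories are càdlàg. $Q$ is irreducible: for every $A\subset\mathbf{V}$ with $A$ and $\mathbf{V}\setminus A$ non-empty there are $a\in A$, $b\in\mathbf{V}\setminus A$ with $q(a,b)\neq0$. $\pi$ is the unique stationary distribution, and $Q$ is reversible: $\pi(x)q(x,y)=\pi(y)q(y,x)$ for all distinct $x,y$. For a probability measure $\mu$ on $\mathbf{V}$, $\mathbb{P}_\mu=\sum_x\mu(x)\mathbb{P}_x$, with expectation $\mathbb{E}_\mu$.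 A path $h:[0,+\infty)\to\mathbf{V}$ is càdlàg if there are $0=t_0<t_1<t_2<\cdots\nearrow+\infty$ with $h$ constant on each $[t_{i-1},t_i)$. The hitting time of $v$ is $H_v=\inf\{t\ge 0: X_t=v\}$. A quasistationary distribution for $\mathbf{V}\setminus\{v\}$ is a probability measure $\mathsf{q}_v$ on $\mathbf{V}$ such that, for all $t\ge 0$ and all $b\in\mathbf{V}$, $\mathbb{P}_{\mathsf{q}_v}(H_v>t)>0$ and $\mathsf{q}_v(b)=\mathbb{P}_{\mathsf{q}_v}(X_t=b\mid H_v>t)$ (in particular $\mathsf{q}_v(v)=0$). *)

(* Defs.v *)
From HB Require Import structures.
From mathcomp Require Import all_boot all_order all_algebra.
From mathcomp Require Import all_classical all_reals all_analysis.
Set Implicit Arguments.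
Unset Strict Implicit.
Unset Printing Implicit Defensive.
Import Order.TTheory GRing.Theory Num.Theory.
Import numFieldNormedType.Exports.
Local Open Scope classical_set_scope.
Local Open Scope ring_scope.

Section Rates.
Context {R : realType} {V : finType}.
Implicit Types (q : V -> V -> R) (mu : V -> R) (x y : V) (t : R).

(* Only the off-diagonal values of the rates [q] are ever used. *)
Definition generator q (f : V -> R) : V -> R :=
  fun x => \sum_(y | y != x) q x y * (f x - f y).

(* The (x, y) entry of the matrix e^{-tQ}, that is (e^{-tQ} 1_{y})(x), where
   e^{-tQ} is the sum of the exponential series and [exp_coeff a k = a^k / k!].
   With the sign convention of [generator], -Q is the usual rate matrix. *)
Definition transition q t x y : R :=
  limn (series (fun k : nat =>
    exp_coeff (- t) k * iter k (generator q) (fun z => (z == y)%:R) x)).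

Definition irreducible_rates q : Prop :=
  forall A : {set V}, A != finset.set0 -> ~: A != finset.set0 ->
    exists a b, [/\ a \in A, b \notin A & q a b != 0].

Definition is_distribution mu : Prop :=
  (forall x, 0 <= mu x) /\ \sum_x mu x = 1.

Definition stationary_distribution q mu : Prop :=
  is_distribution mu /\
  forall t, 0 <= t -> forall y, \sum_x mu x * transition q t x y = mu y.

Definition reversible q mu : Prop :=
  forall x y, x != y -> mu x * q x y = mu y * q y x.

(* Functions on [0, +oo) are encoded as functions on R whose values at negative
   times are irrelevant. *)
Definition cadlag_path (h : R -> V) : Prop :=
  exists u : nat -> R,
    [/\ u 0%N = 0,
        forall i, u i < u i.+1,
        u @ \oo --> +oo &
        forall i s, u i <= s < u i.+1 -> h s = h (u i)].

(* [fdd_weight q x t [:: (t1, y1); ...; (tn, yn)]] is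
   p_{t1-t}(x, y1) p_{t2-t1}(y1, y2) ... p_{tn-t(n-1)}(y(n-1), yn). *)
Fixpoint fdd_weight q x t (s : seq (R * V)) : R :=
  if s is (t', y) :: s' then transition q (t' - t) x y * fdd_weight q y t' s'
  else 1.

End Rates.

Section Process.
Context {R : realType} {V : finType} {d : measure_display}
  {Omega : measurableType d}.
Variables (P : V -> probability Omega R) (X : R -> Omega -> V).
Implicit Types (q : V -> V -> R) (mu : V -> R) (v : V).

(* [P x] is the law of the chain started from x. The Markov property is
   expressed through the finite-dimensional distributions; the times
   [unzip1 s] form a nondecreasing sequence of nonnegative reals, and the case
   s = [:: (0, x)] says that X_0 = x holds P_x-almost surely. *)
Definition chain_realization q : Prop :=
  [/\ forall t y, 0 <= t -> measurable [set w | X t w = y],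
      forall w, cadlag_path (fun t => X t w) &
      forall x (s : seq (R * V)), path (fun a b : R => a <= b) 0 (unzip1 s) ->
        P x [set w | forall p, p \in s -> X p.1 w = p.2] =
        (fdd_weight q x 0 s)%:E].

(* [fine] loses nothing here, since [P x A] is at most 1. *)
Definition prob_from mu (A : set Omega) : R := \sum_x mu x * fine (P x A).

Definition expect_from mu (Y : Omega -> \bar R) : \bar R :=
  (\sum_x (mu x)%:E * \int[P x]_w Y w)%E.

(* The value is +oo on the trajectories that never visit v. *)
Definition hitting_time v (w : Omega) : \bar R :=
  ereal_inf [set t%:E | t in [set t | 0 <= t /\ X t w = v]].

Definition quasistationary v mu : Prop :=
  is_distribution mu /\
  forall t b, 0 <= t ->
    0 < prob_from mu [set w | (t%:E < hitting_time v w)%E] /\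
    mu b = prob_from mu ([set w | X t w = b] `&`
                         [set w | (t%:E < hitting_time v w)%E])
           / prob_from mu [set w | (t%:E < hitting_time v w)%E].

End Process.

(* Main.v *)
Require Import Defs.
From HB Require Import structures.
From mathcomp Require Import all_boot all_order all_algebra.
From mathcomp Require Import all_classical all_reals all_analysis.
From mathcomp Require Import measurable_realfun.
From mathcomp Require Import ring lra.
Set Implicit Arguments.
Unset Strict Implicit.
Unset Printing Implicit Defensive.
Import Order.TTheory GRing.Theory Num.Theory.
Import numFieldNormedType.Exports.
Local Open Scope classical_set_scope.
Local Open Scope ring_scope.

(** Write [<f, g>] for the inner product of L^2(pi) ([dot]) and E for the
    Dirichlet form <f, Qf> ([energy]).  Reversibility makes Q and e^{-tQ}
    self-adjoint.  For a state a, let lambda(a) be the minimum of E(f, f) over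
    the unit functions that vanish at a, and let v minimise lambda(a).

    For a target standing still at a, the law of the surviving chain is governed
    by the generator killed at a, a self-adjoint operator of norm e^{-t lambda(a)}
    at time t.  A moving target h replaces the single killed semigroup by a
    product of killed semigroups at various states, and such a product has norm
    at most e^{-t lambda(v)}; applied to the constant 1, which is a unit vector,
    it bounds the probability of avoiding h.  On the other hand the minimiser f
    of the Rayleigh quotient for v may be taken nonnegative and is then an
    eigenfunction of the generator killed at v, so that pi f, normalised, is a
    quasistationary distribution with survival probability e^{-t lambda(v)}:
    equality is attained.

    The killed semigroups are only approached through the times j t / 2^n.
    Paths are constant to the right of every time, so avoiding h on [0, t] is the
    same as avoiding it at all these times for all n ([cadlag_avoidP]), and the
    probability of avoiding h along one grid is an alternating product of
    transition operators S of step delta and of indicator functions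
    ([prob_grid_event]).

    - Upper bound.  S is a square, hence positive semidefinite, so
      <u, S w>^2 <= <u, S u> <w, S w> even when u and w vanish at different
      states; each factor only involves one state, where
      <u, S u> <= e^{- delta lambda(v) + O(delta^2)} <u, u>
      ([dot_semigroup_le]).  This is how a moving target is reduced to still
      ones ([stay_avoid_norm]), and it makes the number of jumps of h irrelevant.
    - Exact rate.  Pairing the grid probabilities with the eigenfunction f
      multiplies by e^{- delta lambda(v)} + O(delta^2) at each step, with errors
      that do not grow ([stay_eigen]); 2^n steps leave an error O(2^-n).

    The mean hitting time then follows from its tail ([integral_tail]), the
    integral of e^{-t lambda(v)} over t >= 0 being 1 / lambda(v). *)

(** * The Dirichlet form of a reversible chain *)

Section DirichletForm.
Context {R : realType} {V : finType}.
Variables (q : V -> V -> R) (pi : V -> R).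
Implicit Types (f g : V -> R) (a : R).

Definition dot f g : R := \sum_x pi x * f x * g x.

Definition energy f g : R := dot f (generator q g).

Lemma dotC f g : dot f g = dot g f.
Proof. by apply: eq_bigr => x _; rewrite mulrAC. Qed.

Lemma dotDZl f g a h : dot (fun x => f x + a * g x) h = dot f h + a * dot g h.
Proof.
rewrite /dot mulr_sumr -big_split; apply: eq_bigr => x _ /=; ring.
Qed.

Lemma dotffDZ f g a : dot (fun x => f x + a * g x) (fun x => f x + a * g x)
  = dot f f + 2 * a * dot f g + a ^+ 2 * dot g g.
Proof.
rewrite dotDZl !(dotC _ (fun x => f x + a * g x)) !dotDZl (dotC g f); ring.
Qed.

Lemma dot_delta_l f x : dot (fun z => (z == x)%:R) f = pi x * f x.
Proof.
rewrite /dot (bigD1 x)//= eqxx mulr1 big1 ?addr0// => y /negbTE ->.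
by rewrite mulr0 mul0r.
Qed.

Lemma generatorE f x : generator q f x = \sum_y q x y * (f x - f y).
Proof.
rewrite /generator big_mkcond; apply: eq_bigr => y _.
by case: eqVneq => //= ->; rewrite subrr mulr0.
Qed.

Lemma generatorDZ f g a x :
  generator q (fun y => f y + a * g y) x = generator q f x + a * generator q g x.
Proof.
rewrite !generatorE mulr_sumr -big_split; apply: eq_bigr => y _ /=; ring.
Qed.

Lemma generator_delta f x :
  generator q f x = \sum_y generator q (fun z => (z == y)%:R) x * f y.
Proof.
under [RHS]eq_bigr => y _ do rewrite generatorE mulr_suml.
rewrite exchange_big generatorE; apply: eq_bigr => z _ /=.
under eq_bigr => y _ do rewrite -mulrA mulrBl.
rewrite -mulr_sumr sumrB; congr (_ * (_ - _)).
  rewrite (bigD1 x)//= eqxx mul1r big1 ?addr0// => y /negbTE yx.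
  by rewrite eq_sym yx mul0r.
rewrite (bigD1 z)//= eqxx mul1r big1 ?addr0// => y /negbTE yx.
by rewrite eq_sym yx mul0r.
Qed.

Hypothesis pi_gt0 : forall x, 0 < pi x.

Lemma dot_ge0 f g : (forall x, 0 <= f x) -> (forall x, 0 <= g x) -> 0 <= dot f g.
Proof. by move=> f0 g0; apply: sumr_ge0 => x _; rewrite !mulr_ge0// ltW. Qed.

Lemma dotff_ge0 f : 0 <= dot f f.
Proof.
by apply: sumr_ge0 => x _; rewrite -mulrA mulr_ge0 ?(ltW (pi_gt0 x))//
  -expr2 sqr_ge0.
Qed.

Lemma dot_term_le f x : pi x * f x ^+ 2 <= dot f f.
Proof.
rewrite /dot (bigD1 x)//= -mulrA -expr2 lerDl; apply: sumr_ge0 => y _.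
by rewrite -mulrA mulr_ge0 ?(ltW (pi_gt0 y))// -expr2 sqr_ge0.
Qed.

Lemma dotff_eq0 f : dot f f = 0 -> forall x, f x = 0.
Proof.
move=> f0 x; have := dot_term_le f x; rewrite f0 pmulr_rle0// => fx.
by apply/eqP; rewrite -sqrf_eq0 eq_le fx sqr_ge0.
Qed.

Hypothesis q_rev : reversible q pi.

Lemma reversibleT x y : pi x * q x y = pi y * q y x.
Proof. by case: (eqVneq x y) => [->//|]; exact: q_rev. Qed.

(** Symmetrising <f, Qg> in the two endpoints of each edge: this is the form in
    which positivity, symmetry and contraction by absolute value are visible. *)
Lemma energyE f g :
  energy f g = 2^-1 * \sum_x \sum_y pi x * q x y * ((f x - f y) * (g x - g y)).
Proof.
have E1 : energy f g = \sum_x \sum_y pi x * q x y * (f x * (g x - g y)).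
  apply: eq_bigr => x _; rewrite generatorE mulr_sumr.
  by apply: eq_bigr => y _; ring.
have E2 : energy f g = \sum_x \sum_y pi x * q x y * (f y * (g y - g x)).
  rewrite E1 exchange_big; apply: eq_bigr => x _; apply: eq_bigr => y _.
  by rewrite reversibleT.
apply: (@mulfI _ 2) => //; rewrite mulVKf// mulr_natl mulr2n.
rewrite {1}E1 E2 -big_split; apply: eq_bigr => x _ /=; rewrite -big_split.
by apply: eq_bigr => y _ /=; ring.
Qed.

Lemma energyC f g : energy f g = energy g f.
Proof.
rewrite !energyE; congr (_ * _).
by do 2!(apply: eq_bigr => ? _); congr (_ * _); rewrite mulrC.
Qed.

Lemma dot_generatorC f g : dot f (generator q g) = dot (generator q f) g.
Proof. by rewrite [LHS]energyC /energy dotC. Qed.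

Hypothesis q_ge0 : forall x y, x != y -> 0 <= q x y.

Lemma energy_term_ge0 f x y : 0 <= pi x * q x y * ((f x - f y) * (f x - f y)).
Proof.
have [->|xy] := eqVneq x y; first by rewrite subrr !mulr0.
by rewrite -expr2 mulr_ge0 ?sqr_ge0// mulr_ge0 ?q_ge0// ltW.
Qed.

Lemma energy_ge0 f : 0 <= energy f f.
Proof.
rewrite energyE mulr_ge0 ?invr_ge0//.
by do 2!(apply: sumr_ge0 => ? _); exact: energy_term_ge0.
Qed.

Lemma energy_abs f : energy (fun x => `|f x|) (fun x => `|f x|) <= energy f f.
Proof.
rewrite !energyE ler_pM2l ?invr_gt0//.
apply: ler_sum => x _; apply: ler_sum => y _.
have [->|xy] := eqVneq x y; first by rewrite !subrr !mulr0.
rewrite ler_wpM2l ?mulr_ge0 ?q_ge0 ?(ltW (pi_gt0 x))//.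
rewrite -!expr2 -[leLHS]real_normK ?num_real// -[leRHS]real_normK ?num_real//.
by rewrite ler_sqr ?nnegrE// ler_dist_dist.
Qed.

Hypothesis q_irr : irreducible_rates q.

(** The spectral gap of the killed chain is positive: zero energy forces f to
    agree across every edge, and irreducibility carries the value 0 at v to all
    states. *)
Lemma energy_eq0 f v : f v = 0 -> energy f f = 0 -> forall x, f x = 0.
Proof.
move=> fv /eqP; rewrite energyE mulf_eq0 invr_eq0 (negbTE (_ : 2 != 0)) //=.
rewrite psumr_eq0 => [/allP E0|x _]; last first.
  by apply: sumr_ge0 => y _; exact: energy_term_ge0.
have edge x y : q x y != 0 -> f x = f y.
  move=> qxy; have /= := E0 x (mem_index_enum _).
  rewrite psumr_eq0 => [/allP/(_ y (mem_index_enum _))/=|z _]; last first.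
    exact: energy_term_ge0.
  rewrite !mulf_eq0 (gt_eqF (pi_gt0 x)) (negbTE qxy) /= orbb subr_eq0.
  by move/eqP.
pose A := [set x | f x == 0]%SET.
have vA : v \in A by rewrite inE fv.
have A0 : A != finset.set0 by apply/set0Pn; exists v.
have [C0|/(q_irr A0)[a [b [aA bA /edge fab]]]] := eqVneq (~: A)%SET finset.set0.
  move=> x; have : x \notin (~: A)%SET by rewrite C0 finset.in_set0.
  by rewrite !inE negbK => /eqP.
by move: aA bA; rewrite !inE fab => ->.
Qed.

End DirichletForm.

(** * Ground states of the killed chain *)

Section GroundState.
Context {R : realType} {V : finType}.
Variables (q : V -> V -> R) (pi : V -> R).
Hypotheses (pi_gt0 : forall x, 0 < pi x) (q_rev : reversible q pi).
Hypotheses (q_ge0 : forall x y, x != y -> 0 <= q x y).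
Hypothesis q_irr : irreducible_rates q.
Hypothesis V_ge2 : (2 <= #|V|)%N.
Implicit Types (f g : V -> R) (v : V).

(** [lam] is the bottom of the spectrum of the generator killed at [v] and [f] a
    nonnegative unit eigenfunction; the last clause is the Poincare inequality
    with its optimal constant. *)
Definition ground_state v lam f : Prop :=
  [/\ 0 < lam, (forall x, 0 <= f x) /\ f v = 0, dot pi f f = 1,
      forall x, x != v -> generator q f x = lam * f x &
      forall g, g v = 0 -> lam * dot pi g g <= energy q pi g g].

Local Notation F := (prod_topology (fun _ : V => R^o)).

Let continuous_eval x : continuous (fun f : F => f x : R^o).
Proof. exact: (@proj_continuous V (fun _ => R^o) x). Qed.

Let continuous_sum (G : V -> F -> R^o) :
  (forall x, continuous (G x)) -> continuous (fun f : F => \sum_x G x f : R^o).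
Proof.
move=> cG; apply: continuous_big; first exact: add_continuous.
by move=> x _; exact: cG.
Qed.

Let continuous_dotff : continuous (fun f : F => dot pi f f : R^o).
Proof.
apply: continuous_sum => x f; have cx := @continuous_eval x f.
exact: (cvgM (cvgM (cvg_cst (pi x : R^o)) cx) cx).
Qed.

Let continuous_energyff : continuous (fun f : F => energy q pi f f : R^o).
Proof.
have -> : (fun f : F => energy q pi f f) = fun f : F =>
    \sum_x \sum_y 2^-1 * (pi x * q x y) * ((f x - f y) * (f x - f y)).
  apply/funext => f; rewrite energyE// mulr_sumr; apply: eq_bigr => x _.
  rewrite mulr_sumr; apply: eq_bigr => y _; ring.
apply: continuous_sum => x; apply: continuous_sum => y f.
have := cvgB (F := nbhs f) (@continuous_eval x f) (@continuous_eval y f).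
move=> /(_ (nbhs_filter f)) cxy.
exact: (cvgM (cvg_cst (2^-1 * (pi x * q x y) : R^o)) (cvgM cxy cxy)).
Qed.

Lemma energyDZ f g a : energy q pi (fun x => f x + a * g x) (fun x => f x + a * g x)
  = energy q pi f f + 2 * a * energy q pi f g + a ^+ 2 * energy q pi g g.
Proof.
have E h : energy q pi h (fun x => f x + a * g x)
    = energy q pi h f + a * energy q pi h g.
  rewrite /energy (_ : generator q _ = fun x =>
    generator q f x + a * generator q g x); last first.
    by apply/funext => x; exact: generatorDZ.
  by rewrite -!(dotC _ _ h) dotDZl.
rewrite E (energyC q_rev _ f) (energyC q_rev _ g) !E (energyC q_rev g f); ring.
Qed.

(** The unit sphere of L^2(pi) is compact for pointwise convergence, being closed
    in a product of segments, and the energy is continuous. *)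
Lemma rayleigh_minimizer v : exists f, [/\ f v = 0, dot pi f f = 1 &
  forall g, g v = 0 -> dot pi g g = 1 -> energy q pi f f <= energy q pi g g].
Proof.
(* B dominates both 1 and every 1 / pi(x), hence B^2 >= 1 / pi(x) >= f(x)^2 on
   the unit sphere. *)
pose B : R := 1 + \sum_x (pi x)^-1.
pose K := [set f : F | forall x, `[- B, B]%classic (f x)].
pose S := [set f : F | f v = 0] `&` [set f : F | dot pi f f = 1].
have cK : compact (K : set F).
  apply: (@tychonoff _ (fun=> R^o) (fun=> `[- B, B]%classic)) => x.
  exact: segment_compact.
have cS : closed (S : set F).
  apply: closedI.
    exact: (@preimage_closed F R^o (fun f => f v) [set x | x = 0]
      (fun f _ => @continuous_eval v f) (@closed_eq R 0)).
  exact: (@preimage_closed F R^o (fun f => dot pi f f) [set x | x = 1]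
    (fun f _ => @continuous_dotff f) (@closed_eq R 1)).
have SK : S `<=` K.
  move=> f [_ /= f1] x; rewrite /= in_itv/= -ler_norml.
  have pix : (pi x)^-1 <= B.
    rewrite /B (bigD1 x)//= addrCA lerDl addr_ge0//.
    by apply: sumr_ge0 => y _; rewrite invr_ge0 ltW.
  have B1 : 1 <= B.
    by rewrite lerDl sumr_ge0// => y _; rewrite invr_ge0 ltW.
  have B0 : 0 <= B by rewrite (le_trans _ B1).
  rewrite -ler_sqr ?nnegrE// real_normK ?num_real//.
  have := dot_term_le pi_gt0 f x; rewrite f1 -ler_pdivlMl// mulr1 => fx.
  by apply: (le_trans fx); apply: (le_trans pix); rewrite expr2 ler_peMl.
have S0 : S !=set0.
  (* A normalised indicator of another state: this is where V has two points. *)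
  have [w wv] : exists w, w != v.
    apply/existsP; move: V_ge2; apply: contraTT; rewrite negb_exists -ltnNge.
    move=> /forallP vw; rewrite ltnS -[leqRHS](card1 v); apply: subset_leq_card.
    by apply/fintype.subsetP => x _; have := vw x; rewrite negbK inE.
  exists (fun x => (Num.sqrt (pi w))^-1 * (x == w)%:R); split => /=.
    by rewrite eq_sym (negbTE wv) mulr0.
  rewrite /dot (bigD1 w)//= eqxx mulr1 big1 ?addr0 => [|x /negbTE ->].
    by rewrite -mulrA -invfM -expr2 sqr_sqrtr ?divff ?gt_eqF ?(ltW (pi_gt0 w)).
  by rewrite !mulr0.
have [f /set_mem[fv f1] fmin] : exists2 f, f \in S &
    forall g, g \in S -> energy q pi f f <= energy q pi g g.
  apply: compact_EVT_min => //; first exact: subclosed_compact cS cK SK.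
  by apply: continuous_subspaceT; exact: continuous_energyff.
by exists f; split=> // g gv g1; apply: fmin; apply/mem_set.
Qed.

(** Euler-Lagrange equation: perturb the minimiser by a multiple of the indicator
    of [x], which is admissible as [x != v]. *)
Lemma rayleigh_eigenvector v lam f :
  f v = 0 -> dot pi f f = 1 -> energy q pi f f = lam ->
  (forall g, g v = 0 -> lam * dot pi g g <= energy q pi g g) ->
  forall x, x != v -> generator q f x = lam * f x.
Proof.
move=> fv f1 fl min x xv.
pose g y : R := (y == x)%:R.
have gv : g v = 0 by rewrite /g eq_sym (negbTE xv).
have gE h : dot pi g h = pi x * h x by exact: dot_delta_l.
pose a := energy q pi f g - lam * dot pi f g.
pose b := energy q pi g g - lam * dot pi g g.
have b0 : 0 <= b by rewrite subr_ge0 min.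
have ab e : 0 <= 2 * e * a + e ^+ 2 * b.
  have := min (fun x => f x + e * g x).
  by rewrite fv gv mulr0 addr0 energyDZ dotffDZ f1 fl /a /b => /(_ erefl); lra.
have : a = 0.
  have b1 : 0 < b + 1 by lra.
  (* The best perturbation is - a / b; adding 1 covers the case b = 0. *)
  have := ab (- a / (b + 1)).
  have -> : 2 * (- a / (b + 1)) * a + (- a / (b + 1)) ^+ 2 * b
    = - ((a / (b + 1)) ^+ 2 * (b + 2)) by field; lra.
  rewrite oppr_ge0 pmulr_lle0; last by lra.
  move=> le0; have : (a / (b + 1)) ^+ 2 == 0 by rewrite eq_le le0 sqr_ge0.
  by rewrite sqrf_eq0 mulf_eq0 invr_eq0 (gt_eqF b1) orbF => /eqP.
rewrite /a energyC// {1}/energy (dotC _ f) !gE.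
rewrite mulrCA -mulrBr => /eqP; rewrite mulf_eq0 gt_eqF//= subr_eq0.
by move/eqP.
Qed.

(** Absolute value keeps the norm and does not raise the energy, so it turns a
    minimiser into a nonnegative one. *)
Lemma ground_state_exists v : exists lam f, ground_state v lam f.
Proof.
have [f0 [f0v f01 f0min]] := rayleigh_minimizer v.
pose f x := `|f0 x|; have fv : f v = 0 by rewrite /f f0v normr0.
have f1 : dot pi f f = 1.
  rewrite -f01; apply: eq_bigr => x _.
  by rewrite -!mulrA -!expr2 real_normK ?num_real.
have min g : g v = 0 -> energy q pi f f * dot pi g g <= energy q pi g g.
  move=> gv; have [g0|g0] := eqVneq (dot pi g g) 0.
    by rewrite g0 mulr0 energy_ge0.
  have gg : 0 < dot pi g g by rewrite lt_def g0 dotff_ge0.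
  pose c := (Num.sqrt (dot pi g g))^-1.
  have c2 : c ^+ 2 = (dot pi g g)^-1 by rewrite exprVn sqr_sqrtr// ltW.
  (* The rescaled g is written as a perturbation of 0, to reuse the quadratic
     expansions. *)
  have := f0min (fun x => 0 + c * g x); rewrite dotffDZ energyDZ gv mulr0 addr0.
  have dz h : dot pi (fun=> 0) h = 0.
    by rewrite /dot big1// => x _; rewrite mulr0 mul0r.
  have ez h : energy q pi (fun=> 0) h = 0 by exact: dz.
  rewrite !dz !ez !mulr0 !add0r c2 mulVf// => /(_ erefl erefl).
  move=> le; rewrite -ler_pdivlMr// mulrC; apply: le_trans le.
  exact: energy_abs.
have lam0 : 0 < energy q pi f f.
  rewrite lt_def energy_ge0// andbT; apply/eqP => E0.
  have f0' := energy_eq0 pi_gt0 q_rev q_ge0 q_irr fv E0.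
  move: f1; rewrite /dot big1 => [/eqP|x _]; first by rewrite eq_sym oner_eq0.
  by rewrite f0' mulr0.
exists (energy q pi f f), f; split=> //; last exact: rayleigh_eigenvector min.
by split=> // x; exact: normr_ge0.
Qed.

End GroundState.

(** * Transition probabilities: expansion at time 0 and self-adjointness *)

Section Kernel.
Context {R : realType} {V : finType}.
Variables (q : V -> V -> R).
Implicit Types (f g : V -> R) (t : R).

Lemma cvg_exp_series (a : nat -> R) M t : (forall k, `|a k| <= M ^+ k) ->
  cvgn (series (fun k => exp_coeff t k * a k)).
Proof.
move=> aM; apply: normed_cvg.
apply: (@series_le_cvg _ _ (exp_coeff (`|t| * M))) => [k|k|k|].
- exact: normr_ge0.
- have M0 : 0 <= M by rewrite -(expr1 M) (le_trans _ (aM 1)).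
  by rewrite exp_coeff_ge0// mulr_ge0.
- rewrite /exp_coeff /= !normrM normrX (ger0_norm (_ : 0 <= _^-1))//.
  by rewrite exprMn mulrAC ler_wpM2r// ler_wpM2l ?exprn_ge0.
- exact: is_cvg_series_exp_coeff.
Qed.

(** Beyond the first two terms, t^k <= t^2 leaves a factor t^2 in front of an
    exponential series. *)
Lemma exp_series_taylor (a : nat -> R) M t : (forall k, `|a k| <= M ^+ k) ->
  0 <= t <= 1 ->
  `|limn (series (fun k => exp_coeff (- t) k * a k)) - (a 0 - t * a 1)|
    <= t ^+ 2 * expR M.
Proof.
move=> aM /andP[t0 t1]; set s := series _; set c := a 0 - _.
have M0 : 0 <= M by rewrite -(expr1 M) (le_trans _ (aM 1)).
have cs : cvgn s by exact: cvg_exp_series aM.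
have cn : (fun n => `|s n - c|) @ \oo --> `|limn s - c|.
  by apply: cvg_norm; apply: cvgB => //; exact: cvg_cst.
rewrite -(cvg_lim _ cn)//; apply: limr_le;
  first by apply/cvg_ex; eexists; exact: cn.
exists 2%N => // n /= n2.
rewrite -[n](subnKC n2) /s /series/= big_mkord !big_ord_recl/=.
rewrite {1 2}/exp_coeff /= expr0 expr1 /bump /= !fact0 invr1 !mul1r mulr1 mulNr.
rewrite addrA -/c [X in `|X|]addrAC subrr add0r.
apply: (le_trans (ler_norm_sum _ _ _)).
apply: (@le_trans _ _ (t ^+ 2 * series (exp_coeff M) n)); last first.
  rewrite ler_wpM2l ?sqr_ge0//.
  apply: nondecreasing_cvgn_le; last exact: is_cvg_series_exp_coeff.
  by apply: nondecreasing_series => k _ _; exact: exp_coeff_ge0.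
rewrite -[n in leRHS](subnKC n2) /series/= big_mkord !big_ord_recl/=.
rewrite addrA mulrDr -[leLHS]add0r lerD//.
  by rewrite mulr_ge0 ?sqr_ge0// addr_ge0// exp_coeff_ge0.
rewrite mulr_sumr ler_sum// => i _; rewrite /bump/= !add1n.
have : (2 <= i.+2)%N by []; move: i.+2 => k k2.
rewrite /exp_coeff /= !normrM normrX normrN (ger0_norm t0).
rewrite (ger0_norm (_ : 0 <= _^-1))// -mulrA.
apply: ler_pM; rewrite ?mulr_ge0 ?exprn_ge0//; first exact: ler_wiXn2l.
by rewrite mulrC ler_wpM2r.
Qed.

Lemma expR_quadratic t : 0 <= t -> `|1 - t - expR (- t)| <= t ^+ 2.
Proof.
move=> t0; have e1 := expR_ge1Dx (- t).
have e2 : expR (- t) <= (1 + t)^-1.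
  by rewrite expRN lef_pV2 ?posrE ?expR_gt0 ?expR_ge1Dx//; lra.
have e3 : (1 + t)^-1 <= 1 - t + t ^+ 2.
  rewrite -(ler_pM2l (_ : 0 < 1 + t)) ?divff; [|lra..].
  have -> : (1 + t) * (1 - t + t ^+ 2) = 1 + t ^+ 3 by ring.
  by rewrite lerDl exprn_ge0.
by rewrite distrC ger0_norm; lra.
Qed.

Local Notation delta y := (fun z => (z == y)%:R).

Definition rate_bound : R := 2 * \sum_x \sum_y `|q x y|.

Lemma generator_bound f c : (forall x, `|f x| <= c) ->
  forall x, `|generator q f x| <= rate_bound * c.
Proof.
move=> fc x; rewrite generatorE (le_trans (ler_norm_sum _ _ _))//.
have c0 : 0 <= c by apply: le_trans (fc x).
have row : \sum_y `|q x y| <= \sum_x \sum_y `|q x y|.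
  rewrite [leRHS](bigD1 x)//= lerDl.
  by apply: sumr_ge0 => z _; apply: sumr_ge0.
rewrite /rate_bound mulrAC; apply: le_trans (_ : 2 * c * \sum_y `|q x y| <= _).
  rewrite mulr_sumr ler_sum// => y _; rewrite normrM mulrC ler_wpM2r//.
  by rewrite mulr_natl mulr2n (le_trans (ler_normB _ _))// lerD.
by rewrite ler_wpM2l// mulr_ge0.
Qed.

Lemma iter_generator_bound k x y :
  `|iter k (generator q) (delta y) x| <= rate_bound ^+ k.
Proof.
elim: k x => [|k IH] x /=; last by rewrite exprS; exact: generator_bound.
by case: eqP; rewrite ?normr0 ?normr1.
Qed.

Lemma transition_cvg t x y : series (fun k : nat =>
  exp_coeff (- t) k * iter k (generator q) (delta y) x) @ \oo
    --> transition q t x y.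
Proof. exact: cvg_exp_series (fun k => iter_generator_bound k x y). Qed.

Definition transition_error t x y : R :=
  transition q t x y - ((x == y)%:R - t * generator q (delta y) x).

Lemma transition_error_bound t x y : 0 <= t <= 1 ->
  `|transition_error t x y| <= t ^+ 2 * expR rate_bound.
Proof.
exact: (exp_series_taylor (fun k => iter_generator_bound k x y)).
Qed.

Lemma transition0 x y : transition q 0 x y = (x == y)%:R.
Proof.
have := @transition_error_bound 0 x y; rewrite lexx ler01 => /(_ isT).
rewrite expr2 mul0r mul0r normr_le0 /transition_error mul0r subr0 subr_eq0.
by move/eqP.
Qed.

Variable pi : V -> R.
Hypothesis q_rev : reversible q pi.

Lemma dot_iter_generatorC k f g :
  dot pi f (iter k (generator q) g) = dot pi (iter k (generator q) f) g.
Proof.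
elim: k f => [//|k IH] f.
by rewrite -[iter _ _ g]/(generator q _) dot_generatorC// IH -iterSr.
Qed.

(** Detailed balance passes from the rates to every power of the generator, hence
    to the exponential series term by term. *)
Lemma transition_reversible t x y :
  pi x * transition q t x y = pi y * transition q t y x.
Proof.
have cZ a b := cvgM (cvg_cst (pi a)) (@transition_cvg t a b).
rewrite -(cvg_lim _ (cZ _ _ x y))// -(cvg_lim _ (cZ _ _ y x))//.
congr (limn _); apply/funext => n /=; rewrite !mulr_sumr; apply: eq_bigr => k _.
by rewrite mulrCA -dot_delta_l dot_iter_generatorC dotC dot_delta_l mulrCA.
Qed.

Definition semigroup t f : V -> R := fun x => \sum_y transition q t x y * f y.

Lemma dot_semigroupC t f g : dot pi f (semigroup t g) = dot pi (semigroup t f) g.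
Proof.
rewrite /dot /semigroup.
under eq_bigr => x _ do rewrite mulr_sumr.
rewrite exchange_big; apply: eq_bigr => y _; rewrite mulr_sumr mulr_suml.
apply: eq_bigr => x _ /=.
transitivity (pi x * transition q t x y * (f x * g y)); first by ring.
by rewrite transition_reversible; ring.
Qed.

Lemma transition_error_reversible t x y :
  pi x * transition_error t x y = pi y * transition_error t y x.
Proof.
have key : pi x * generator q (delta y) x = pi y * generator q (delta x) y.
  by rewrite -!dot_delta_l dot_generatorC// dotC.
rewrite /transition_error !mulrBr transition_reversible ![pi _ * (t * _)]mulrCA key.
by have [->//|xy] := eqVneq x y; rewrite !mulr0.
Qed.

Lemma semigroup_expansion t f x : semigroup t f x =
  f x - t * generator q f x + \sum_y transition_error t x y * f y.
Proof.
rewrite (generator_delta q f) mulr_sumr.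
have -> : f x = \sum_y (x == y)%:R * f y.
  rewrite (bigD1 x)//= eqxx mul1r big1 ?addr0// => y /negbTE.
  by rewrite eq_sym => ->; rewrite mul0r.
rewrite -sumrB -big_split; apply: eq_bigr => y _ /=.
rewrite /transition_error; ring.
Qed.

Definition expansion_const : R := #|V|%:R * expR rate_bound.

Lemma transition_error_sum t x : 0 <= t <= 1 ->
  \sum_y `|transition_error t x y| <= expansion_const * t ^+ 2.
Proof.
move=> t01.
apply: (le_trans (ler_sum _ (fun y _ => transition_error_bound x y t01))).
by rewrite sumr_const -mulr_natl /expansion_const -mulrA [expR _ * _]mulrC.
Qed.

End Kernel.

(** * Estimates along a time grid *)

Section KilledGrid.
Context {R : realType} {V : finType}.
Variables (q : V -> V -> R) (pi : V -> R).
Hypotheses (pi_gt0 : forall x, 0 < pi x) (pi_sum1 : \sum_x pi x = 1).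
Hypothesis q_rev : reversible q pi.
Hypothesis p_ge0 : forall t x y, 0 <= t -> 0 <= transition q t x y.
Hypothesis p_sum1 : forall t x, 0 <= t -> \sum_y transition q t x y = 1.
Hypothesis p_add : forall s t x y, 0 <= s -> 0 <= t ->
  transition q (s + t) x y = \sum_z transition q s x z * transition q t z y.
Implicit Types (f g : V -> R) (t delta : R).

Lemma dot_CauchySchwarz f g : dot pi f g ^+ 2 <= dot pi f f * dot pi g g.
Proof.
have [g0|g0] := eqVneq (dot pi g g) 0.
  rewrite g0 mulr0 [dot pi f g]big1 ?expr0n// => x _.
  by rewrite (dotff_eq0 pi_gt0 g0) mulr0.
have gg : 0 < dot pi g g by rewrite lt_def g0 dotff_ge0.
have := dotff_ge0 pi_gt0 (fun x => f x + (- dot pi f g / dot pi g g) * g x).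
rewrite dotffDZ.
have -> : dot pi f f + 2 * (- dot pi f g / dot pi g g) * dot pi f g
  + (- dot pi f g / dot pi g g) ^+ 2 * dot pi g g
  = (dot pi f f * dot pi g g - dot pi f g ^+ 2) / dot pi g g by field; rewrite g0.
by rewrite pmulr_lge0 ?invr_gt0// subr_ge0.
Qed.

Lemma semigroupD s t f x : 0 <= s -> 0 <= t ->
  semigroup q (s + t) f x = semigroup q s (semigroup q t f) x.
Proof.
move=> s0 t0; rewrite /semigroup.
under [LHS]eq_bigr => y _ do rewrite p_add// mulr_suml.
rewrite exchange_big; apply: eq_bigr => z _ /=.
by rewrite mulr_sumr; apply: eq_bigr => y _; rewrite mulrA.
Qed.

(** Being the square of its self-adjoint half-time version, the transition
    operator is positive semidefinite. *)
Lemma dot_semigroup_half t f g : 0 <= t -> dot pi f (semigroup q t g) =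
  dot pi (semigroup q (t / 2) f) (semigroup q (t / 2) g).
Proof.
move=> t0; rewrite -dot_semigroupC//; congr (dot pi f _); apply/funext => x.
by rewrite -semigroupD ?divr_ge0// -splitr.
Qed.

(** The step that separates the two endpoints of a time step: on the right each
    factor only involves one function, hence only one position of the target. *)
Lemma semigroup_CauchySchwarz t f g : 0 <= t ->
  dot pi f (semigroup q t g) ^+ 2
    <= dot pi f (semigroup q t f) * dot pi g (semigroup q t g).
Proof.
move=> t0; rewrite (dot_semigroup_half f g t0) (dot_semigroup_half f f t0).
by rewrite (dot_semigroup_half g g t0) dot_CauchySchwarz.
Qed.

Local Notation C := (expansion_const q).

(** Schur's test: the kernel of errors is symmetric for pi, so bounding its row
    sums bounds it as an operator. *)
Lemma dot_error_bound t f : 0 <= t <= 1 ->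
  dot pi f (fun x => \sum_y transition_error q t x y * f y)
    <= C * t ^+ 2 * dot pi f f.
Proof.
move=> t01; pose r x y := `|transition_error q t x y|.
have rC x y : pi x * r x y = pi y * r y x.
  rewrite -[pi x]gtr0_norm// -[pi y]gtr0_norm// -!normrM.
  by rewrite transition_error_reversible.
apply: (@le_trans _ _ (\sum_x \sum_y pi x * r x y * f x ^+ 2)); last first.
  rewrite /dot mulr_sumr; apply: ler_sum => x _.
  rewrite (_ : \sum_y _ = (\sum_y r x y) * (pi x * f x * f x)); last first.
    by rewrite mulr_suml; apply: eq_bigr => y _; ring.
  rewrite ler_wpM2r//.
    by rewrite -mulrA -expr2 mulr_ge0 ?sqr_ge0 ?(ltW (pi_gt0 x)).
  exact: transition_error_sum.
have -> : \sum_x \sum_y pi x * r x y * f x ^+ 2 =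
    \sum_x \sum_y pi x * r x y * ((f x ^+ 2 + f y ^+ 2) / 2).
  apply: (@mulfI _ 2) => //; rewrite mulr_natl mulr2n.
  rewrite {1}exchange_big -big_split mulr_sumr; apply: eq_bigr => x _ /=.
  rewrite -big_split mulr_sumr; apply: eq_bigr => y _ /=.
  by rewrite (rC y); field.
apply: ler_sum => x _; rewrite mulr_sumr; apply: ler_sum => y _.
rewrite -!mulrA ler_pM2l//.
apply: (le_trans (ler_norm _)); rewrite !normrM mulrCA ler_wpM2l//.
rewrite -(real_normK (num_real (f x))) -(real_normK (num_real (f y))).
by have := sqr_ge0 (`|f x| - `|f y|); lra.
Qed.

(** First-order expansion of <f, S f>, then 1 + z <= e^z so that powers become
    multiples of the exponent. *)
Lemma dot_semigroup_le lam t f : 0 <= t <= 1 ->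
  lam * dot pi f f <= energy q pi f f ->
  dot pi f (semigroup q t f) <= expR (- (t * lam) + C * t ^+ 2) * dot pi f f.
Proof.
move=> t01 lamE; have /andP[t0 _] := t01.
have -> : dot pi f (semigroup q t f) = dot pi f f + - t * energy q pi f f +
    dot pi f (fun x => \sum_y transition_error q t x y * f y).
  rewrite /energy /dot mulr_sumr -!big_split; apply: eq_bigr => x _ /=.
  rewrite semigroup_expansion; ring.
apply: (@le_trans _ _ ((1 + (- (t * lam) + C * t ^+ 2)) * dot pi f f)).
  have := dot_error_bound f t01; have := ler_wpM2l t0 lamE; lra.
by rewrite ler_wpM2r ?dotff_ge0// expR_ge1Dx.
Qed.

(** The probability, as a function of the starting point, that the chain observed
    at times 0, delta, 2 delta, ... is in the successive sets of the list. *)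
Fixpoint stay delta (s : seq (pred V)) : V -> R :=
  if s is A :: s' then fun x => (A x)%:R * semigroup q delta (stay delta s') x
  else fun=> 1.

Lemma semigroup1 t x : 0 <= t -> semigroup q t (fun=> 1) x = 1.
Proof.
by move=> t0; rewrite -[RHS](p_sum1 x t0); apply: eq_bigr => y _; rewrite mulr1.
Qed.

Lemma stay01 delta s x : 0 <= delta -> 0 <= stay delta s x <= 1.
Proof.
move=> d0; elim: s x => [|A s IH] x /=; first by rewrite ler01 lexx.
have -> : (A x)%:R = (if A x then 1 else 0) :> R by case: (A x).
case: ifP => _; last by rewrite mul0r lexx ler01.
rewrite mul1r; apply/andP; split.
  by apply: sumr_ge0 => y _; rewrite mulr_ge0 ?p_ge0//; case/andP: (IH y).
rewrite -[leRHS](semigroup1 x d0); apply: ler_sum => y _.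
by rewrite ler_wpM2l ?p_ge0//; case/andP: (IH y).
Qed.

Section Avoid.
Variables (lam delta : R).
Hypothesis lamE : forall v g, g v = 0 -> lam * dot pi g g <= energy q pi g g.
Hypothesis delta01 : 0 <= delta <= 1.
Local Notation rho := (expR (- (delta * lam) + C * delta ^+ 2)).
Local Notation avoid hs := (stay delta [seq (predC1 h : pred V) | h <- hs]).

(** One step: u = 1_{.<>h} S w gives <u, u> = <u, S w>, and Cauchy-Schwarz for S
    bounds this by rho |u| |w|, because u vanishes at h and w at the next
    target. *)
Lemma stay_avoid_norm h hs :
  dot pi (avoid (h :: hs)) (avoid (h :: hs)) <= (rho ^+ 2) ^+ size hs.
Proof.
have d0 : 0 <= delta by case/andP: delta01.
elim: hs h => [|k hs IH] h.
  rewrite expr0 -pi_sum1; apply: ler_sum => x _.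
  rewrite -mulrA -[leRHS]mulr1 ler_pM2l//= semigroup1// mulr1.
  by case: eqP; rewrite ?mul0r ?mulr1.
have := IH k; set w := avoid (k :: hs); set u := avoid _.
have uE x : u x = (x != h)%:R * semigroup q delta w x by [].
have uh : u h = 0 by rewrite uE eqxx mul0r.
have wk : w k = 0 by rewrite /w /= eqxx mul0r.
move: w u uE uh wk => w u uE uh wk IHw.
have uu : dot pi u u = dot pi u (semigroup q delta w).
  apply: eq_bigr => x _; have [->|xh] := eqVneq x h.
    by rewrite uh !mulr0 ?mul0r.
  by rewrite {2}uE xh mul1r.
have u2 : dot pi u u * dot pi u u <= (rho * dot pi u u) * (rho * dot pi w w).
  rewrite -expr2 {1}uu; apply: (le_trans (semigroup_CauchySchwarz _ _ d0)).
  apply: ler_pM.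
  - by rewrite (dot_semigroup_half _ _ d0) dotff_ge0.
  - by rewrite (dot_semigroup_half _ _ d0) dotff_ge0.
  - exact: dot_semigroup_le (lamE uh).
  - exact: dot_semigroup_le (lamE wk).
have [->|u0] := eqVneq (dot pi u u) 0; first by rewrite !exprn_ge0// expR_ge0.
have ugt0 : 0 < dot pi u u by rewrite lt_def u0 dotff_ge0.
rewrite /= [leRHS]exprS; apply: (@le_trans _ _ (rho ^+ 2 * dot pi w w)).
  by rewrite -(ler_pM2l ugt0) (le_trans u2)// expr2; lra.
by rewrite ler_wpM2l ?sqr_ge0.
Qed.

(** Cauchy-Schwarz against the constant 1, a unit vector because pi has mass 1. *)
Lemma stay_avoid_le h hs :
  \sum_x pi x * avoid (h :: hs) x <= rho ^+ size hs.
Proof.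
set u := avoid _; have -> : \sum_x pi x * u x = dot pi (fun=> 1) u.
  by apply: eq_bigr => x _; rewrite mulr1.
have d0 : 0 <= delta by case/andP: delta01.
rewrite -ler_sqr ?nnegrE ?exprn_ge0 ?expR_ge0//; last first.
  apply: dot_ge0 => // x.
  by case/andP: (stay01 [seq (predC1 h : pred V) | h <- h :: hs] x d0).
apply: (le_trans (dot_CauchySchwarz _ _)).
rewrite [X in X * _](_ : _ = 1) ?mul1r; last first.
  by rewrite -[RHS]pi_sum1; apply: eq_bigr => x _; rewrite !mulr1.
by rewrite exprAC; exact: stay_avoid_norm.
Qed.

End Avoid.

Section Eigenvector.
Variables (v : V) (lam delta : R) (f : V -> R).
Hypotheses (lam0 : 0 <= lam) (f0 : forall x, 0 <= f x) (fv : f v = 0).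
Hypothesis fE : forall x, x != v -> generator q f x = lam * f x.
Hypothesis delta01 : 0 <= delta <= 1.

Definition eigen_const : R := (C + lam ^+ 2) * \sum_x f x.

(** An eigenfunction of the generator killed at [v] is, off [v], almost an
    eigenfunction of the transition operator over a short time. *)
Lemma semigroup_eigen x : x != v ->
  `|semigroup q delta f x - expR (- (lam * delta)) * f x|
    <= eigen_const * delta ^+ 2.
Proof.
move=> xv; have d0 : 0 <= delta by case/andP: delta01.
have fle y : f y <= \sum_x f x by rewrite (bigD1 y)//= lerDl sumr_ge0.
have F0 : 0 <= \sum_x f x by rewrite sumr_ge0.
rewrite semigroup_expansion fE//.
have -> : f x - delta * (lam * f x) +
    \sum_y transition_error q delta x y * f y - expR (- (lam * delta)) * f x
  = (1 - lam * delta - expR (- (lam * delta))) * f x +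
    \sum_y transition_error q delta x y * f y by ring.
apply: (le_trans (ler_normD _ _)).
rewrite addrC (_ : eigen_const * _ = C * delta ^+ 2 * (\sum_x f x)
  + (lam * delta) ^+ 2 * \sum_x f x); last by rewrite /eigen_const; ring.
apply: lerD.
  apply: (le_trans (ler_norm_sum _ _ _)).
  apply: (@le_trans _ _ (\sum_y `|transition_error q delta x y| * \sum_x f x)).
    by apply: ler_sum => y _; rewrite normrM (ger0_norm (f0 y)) ler_wpM2l.
  by rewrite -mulr_suml ler_wpM2r// transition_error_sum.
rewrite normrM (ger0_norm (f0 x)).
by apply: ler_pM => //; apply: expR_quadratic; rewrite mulr_ge0.
Qed.

(** Each step is moved onto f by self-adjointness.  Errors simply add up: the
    survival probabilities stay in [0, 1] and the multiplier is at most 1. *)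
Lemma stay_eigen (A : pred V) n : {subset A <= predC1 v} ->
  `|dot pi f (stay delta (rcons (nseq n (predC1 v : pred V)) A))
    - expR (- (lam * delta)) ^+ n * dot pi f (fun x => (A x)%:R)|
    <= n%:R * (eigen_const * delta ^+ 2).
Proof.
move=> Av; have d0 : 0 <= delta by case/andP: delta01.
elim: n => [|n IH].
  rewrite expr0 mul1r mul0r normr_le0 subr_eq0; apply/eqP; congr (dot pi f _).
  by apply/funext => x /=; rewrite semigroup1// mulr1.
set w := stay _ _ in IH; set e := expR _ in IH *.
set fA := dot pi f (fun x => (A x)%:R) in IH *.
have wv : w v = 0.
  rewrite /w; case: (n) => [|m] /=; last by rewrite eqxx mul0r.
  have := Av v; rewrite inE eqxx [v \in A]unfold_in.
  by case: (A v) => [/(_ isT)|_]//; rewrite mul0r.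
have w01 x : 0 <= w x <= 1 by exact: stay01.
have -> : dot pi f (stay delta (rcons (nseq n.+1 (predC1 v : pred V)) A)) =
    dot pi (semigroup q delta f) w.
  rewrite -dot_semigroupC//; apply: eq_bigr => x _ /=; rewrite -!mulrA.
  congr (_ * _); rewrite -/w.
  by case: eqP => [->|_] /=; rewrite ?fv ?mul0r// mul1r.
have step : `|dot pi (semigroup q delta f) w - e * dot pi f w|
    <= eigen_const * delta ^+ 2.
  rewrite /dot mulr_sumr -sumrB (le_trans (ler_norm_sum _ _ _))//.
  rewrite -[leRHS]mul1r -pi_sum1 mulr_suml; apply: ler_sum => x _.
  have [->|xv] := eqVneq x v.
    rewrite wv !mulr0 subrr normr0 mulr_ge0 ?(ltW (pi_gt0 v))//.
    rewrite mulr_ge0 ?sqr_ge0// mulr_ge0 ?sumr_ge0// addr_ge0 ?sqr_ge0//.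
    by rewrite mulr_ge0 ?expR_ge0.
  have -> : pi x * semigroup q delta f x * w x - e * (pi x * f x * w x) =
      pi x * ((semigroup q delta f x - e * f x) * w x) by ring.
  rewrite normrM gtr0_norm// ler_pM2l// normrM.
  have /andP[w0 w1] := w01 x; rewrite (ger0_norm w0).
  by rewrite -[leRHS]mulr1 ler_pM// semigroup_eigen.
rewrite -natr1 mulrDl mul1r.
have -> : dot pi (semigroup q delta f) w - e ^+ n.+1 * fA =
  e * (dot pi f w - e ^+ n * fA) +
  (dot pi (semigroup q delta f) w - e * dot pi f w).
  by rewrite [e ^+ _.+1]exprS; ring.
apply: (le_trans (ler_normD _ _)); apply: lerD => //.
rewrite normrM; apply: le_trans IH; rewrite ger0_norm ?expR_ge0//.
by rewrite -[leRHS]mul1r ler_wpM2r// /e -expR0 ler_expR oppr_le0 mulr_ge0.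
Qed.

End Eigenvector.

End KilledGrid.

(** * Piecewise constant paths and the law of the chain on a grid *)

Section Paths.
Context {R : realType} {V : finType}.
Implicit Types (g h : R -> V) (s t : R).

Lemma cadlag_constant_right h s : cadlag_path h -> 0 <= s ->
  exists2 e, 0 < e & forall r, s <= r < s + e -> h r = h s.
Proof.
move=> [u [u0 uS /cvgryPgt/(_ s)[N _ uN] hu]] s0.
have ex : exists n, s < u n by exists N; exact: (uN N (leqnn N)).
have [n un nmin] := ex_minnP ex.
case: n un nmin => [|n] un nmin; first by move: un; rewrite u0 ltNge s0.
have uns : u n <= s by rewrite leNgt; apply/negP => /nmin; rewrite ltnn.
exists (u n.+1 - s) => [|r /andP[sr rn]]; first by rewrite subr_gt0.
rewrite [RHS](hu n) ?uns ?un//; apply: hu.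
by rewrite (le_trans uns sr)/=; move: rn; rewrite addrC subrK.
Qed.

Definition mesh t n : R := t / 2 ^+ n.

Lemma mesh_ge0 t n : 0 <= t -> 0 <= mesh t n.
Proof. by move=> t0; rewrite divr_ge0// exprn_ge0. Qed.

Lemma mesh_total t n : (2 ^ n)%:R * mesh t n = t.
Proof. by rewrite natrX mulrCA divff ?mulr1// expf_neq0. Qed.

Lemma mesh_cvg0 t : mesh t n @[n --> \oo] --> 0.
Proof.
rewrite -[X in _ --> X](mulr0 t).
under eq_fun => n do rewrite /mesh -exprVn.
apply: cvgM; first exact: cvg_cst.
by apply: cvg_expr; rewrite ger0_norm ?invr_ge0// invf_lt1 ?ltr1n.
Qed.

Lemma mesh_le1 t : \forall n \near \oo, mesh t n <= 1.
Proof.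
have /cvgrPdist_lt/(_ 1 ltr01) := mesh_cvg0 t.
apply: filterS => n; rewrite sub0r normrN => /ltW; exact: le_trans (ler_norm _).
Qed.

Lemma mesh_meets t s e : 0 <= s < t -> 0 < e ->
  exists n j, (j <= 2 ^ n)%N /\ s <= j%:R * mesh t n < s + e.
Proof.
move=> /andP[s0 st] e0; have t0 : 0 < t by rewrite (le_lt_trans s0).
have [n _ /(_ n (leqnn n)) ne] : \forall n \near \oo, mesh t n < e.
  have /cvgrPdist_lt/(_ e e0) := mesh_cvg0 t.
  apply: filterS => n; rewrite sub0r normrN; exact: le_lt_trans (ler_norm _).
have m0 : 0 < mesh t n by rewrite divr_gt0// exprn_gt0.
pose j := Num.truncn (s / mesh t n).
have /andP[jl ju] := truncn_itv (divr_ge0 s0 (ltW m0)).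
exists n, j.+1; split.
  rewrite truncn_lt_nat; last exact: divr_ge0 s0 (ltW m0).
  by rewrite ltr_pdivrMr// mesh_total.
move: ju jl; rewrite -/j ltr_pdivrMr// ler_pdivlMr// => ju jl.
apply/andP; split; first exact: ltW.
by rewrite -natr1 mulrDl mul1r ler_ltD.
Qed.

(** Two paths that meet at a time s < t stay together on some [s, s + e), which
    contains a point of a fine enough grid; a meeting at time t is seen by every
    grid.  So countably many conditions suffice, which gives measurability and
    limits. *)
Lemma cadlag_avoidP g h t : cadlag_path g -> cadlag_path h -> 0 <= t ->
  (forall s, 0 <= s <= t -> g s <> h s) <->
  (forall n j, (j <= 2 ^ n)%N -> g (j%:R * mesh t n) <> h (j%:R * mesh t n)).
Proof.
move=> cg ch t0; split=> [gh n j jn|gh s /andP[s0]].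
  apply: gh; rewrite mulr_ge0 ?mesh_ge0//= -[leRHS](mesh_total t n).
  by rewrite ler_wpM2r ?mesh_ge0// ler_nat.
rewrite le_eqVlt => /predU1P[->|st] ghs.
  by apply: (gh 0%N 1%N) => //; rewrite mul1r /mesh expr0 divr1.
have [e e0 ge] := cadlag_constant_right cg s0.
have [e' e'0 he] := cadlag_constant_right ch s0.
have m0 : 0 < Num.min e e' by rewrite lt_min e0.
have [n [j [jn /andP[sj js]]]] := @mesh_meets t s _ (introT andP (conj s0 st)) m0.
apply: (gh n j jn); rewrite ge ?he// sj/= (lt_le_trans js)// lerD2l.
  by rewrite ge_min lexx orbT.
by rewrite ge_min lexx.
Qed.

End Paths.

Section GridLaw.
Context {R : realType} {V : finType} {d : measure_display}
  {Omega : measurableType d}.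
Variables (P : V -> probability Omega R) (X : R -> Omega -> V).
Variable q : V -> V -> R.
Hypothesis X_chain : chain_realization P X q.
Implicit Types (x y v : V) (s t delta : R) (E : set Omega).

Definition prob x E : R := fine (P x E).

Lemma measurable_state t y : 0 <= t -> measurable [set w | X t w = y].
Proof. by case: X_chain => + _ _; exact. Qed.

Lemma measurable_state_in t (A : pred V) : 0 <= t ->
  measurable [set w | A (X t w)].
Proof.
move=> t0; rewrite [X in measurable X](_ : _ =
  \bigcup_(y in [set y | A y]) [set w | X t w = y]); last first.
  apply/seteqP; split=> w.
    by exists (X t w).
  by move=> [y Ay] /= ->.
apply: fin_bigcup_measurable => [|y _]; first exact: finite_finset.
exact: measurable_state.
Qed.

Lemma prob_ge0 x E : 0 <= prob x E.
Proof. by rewrite fine_ge0. Qed.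

Lemma probE x E : measurable E -> P x E = (prob x E)%:E.
Proof. by move=> mE; rewrite fineK// fin_num_measure. Qed.

Lemma prob_le x E F : measurable E -> measurable F -> E `<=` F ->
  prob x E <= prob x F.
Proof.
by move=> mE mF EF; rewrite -lee_fin -!probE// le_measure ?inE.
Qed.

Lemma prob_split t x E : 0 <= t -> measurable E ->
  prob x E = \sum_y prob x (E `&` [set w | X t w = y]).
Proof.
move=> t0 mE; have mF y : measurable (E `&` [set w | X t w = y]).
  by apply: measurableI => //; exact: measurable_state.
have split_seq (l : seq V) : uniq l ->
    (P x (E `&` [set w | X t w \in l]) =
    (\sum_(y <- l) prob x (E `&` [set w | X t w = y]))%:E)%E.
  elim: l => [_|y l IH /= /andP[yl ul]].
    rewrite big_nil [X in P x X](_ : _ = set0) ?measure0//.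
    by apply/seteqP; split=> w [].
  rewrite big_cons EFinD -IH// -probE//.
  rewrite -measureU//.
  - rewrite -setIUr; congr (P x (_ `&` _)); apply/seteqP; split=> w /=.
      by rewrite inE => /predU1P[->|]; [left|right].
    by case=> [->|wl]; rewrite inE ?eqxx// wl orbT.
  - by apply: measurableI => //; exact: (@measurable_state_in t (mem l)).
  - by apply/seteqP; split=> // w [[_ /= ->] [_ /=]]; rewrite (negbTE yl).
apply: EFin_inj; rewrite -split_seq ?index_enum_uniq// -probE//.
congr (P x _); apply/seteqP; split=> [w Ew|w []//]; split=> //=.
exact: mem_index_enum.
Qed.

Lemma fdd x (l : seq (R * V)) : path <=%R 0 (unzip1 l) ->
  prob x [set w | forall p, p \in l -> X p.1 w = p.2] = fdd_weight q x 0 l.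
Proof. by case: X_chain => _ _ F pl; rewrite /prob F. Qed.

Lemma transitionE t x y : 0 <= t ->
  transition q t x y = prob x [set w | X t w = y].
Proof.
move=> t0; have := @fdd x [:: (t, y)]; rewrite /= t0 subr0 mulr1 => <-//.
congr (prob x _); apply/seteqP; split=> w /= => [|Xw p].
  by move=> /(_ (t, y)); apply; rewrite mem_head.
by rewrite inE => /eqP ->.
Qed.

Lemma transition_ge0 t x y : 0 <= t -> 0 <= transition q t x y.
Proof. by move=> t0; rewrite transitionE// prob_ge0. Qed.

Lemma transition_sum1 t x : 0 <= t -> \sum_y transition q t x y = 1.
Proof.
move=> t0; have -> : 1 = prob x setT by rewrite /prob probability_setT.
rewrite (@prob_split t)//; apply: eq_bigr => y _.
by rewrite transitionE// setTI.
Qed.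

(** Chapman-Kolmogorov, read off the finite-dimensional distributions of the
    process instead of the exponential series. *)
Lemma transitionD s t x y : 0 <= s -> 0 <= t ->
  transition q (s + t) x y = \sum_z transition q s x z * transition q t z y.
Proof.
move=> s0 t0; rewrite transitionE ?addr_ge0// (@prob_split s)//; last first.
  by apply: measurable_state; exact: addr_ge0.
apply: eq_bigr => z _; have := @fdd x [:: (s, z); (s + t, y)].
rewrite /= s0 lerDl t0 subr0 addrAC subrr add0r mulr1 => <-//.
congr (prob x _); apply/seteqP; split=> w /=.
  by move=> [Xt Xs] p; rewrite !inE => /orP[]/eqP->.
move=> H; split; first by apply: (H (s + t, y)); rewrite !inE eqxx orbT.
by apply: (H (s, z)); rewrite inE eqxx.
Qed.

(** Gaps between observation times, instead of the times themselves, keep the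
    list of remaining constraints meaningful from any starting time. *)
Fixpoint visits t (l : seq (R * pred V)) : set Omega :=
  if l is (e, A) :: l' then [set w | A (X (t + e) w)] `&` visits (t + e) l'
  else setT.

Fixpoint visit_prob (l : seq (R * pred V)) : V -> R :=
  if l is (e, A) :: l' then
    semigroup q e (fun z => (A z)%:R * visit_prob l' z)
  else fun=> 1.

Lemma measurable_visits t l : 0 <= t -> all (>= 0) (unzip1 l) ->
  measurable (visits t l).
Proof.
elim: l t => [t _ _|[e A] l IH t t0 /= /andP[e0 l0]]; first exact: measurableT.
have te0 : 0 <= t + e by rewrite addr_ge0.
by apply: measurableI; [exact: measurable_state_in|exact: IH].
Qed.

Lemma fdd_weight_rcons x t l t' y : fdd_weight q x t (rcons l (t', y)) =
  fdd_weight q x t l *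
    transition q (t' - last t (unzip1 l)) (last x (unzip2 l)) y.
Proof.
elim: l x t => [|[u z] l IH] x t /=; first by rewrite mulr1 mul1r.
by rewrite IH mulrA.
Qed.

Lemma path_le_last (a : R) l : path <=%R a l -> a <= last a l.
Proof. by elim: l a => //= b l IH a /andP[ab /IH]; exact: le_trans. Qed.

Lemma measurable_fdd (l : seq (R * V)) : path <=%R 0 (unzip1 l) ->
  measurable [set w | forall p, p \in l -> X p.1 w = p.2].
Proof.
move=> pl; have l0 : all (>= 0) (unzip1 l) by exact: (order_path_min le_trans).
elim: l l0 {pl} => [_|p l IH /= /andP[p0 /IH ml]].
  by rewrite [X in measurable X](_ : _ = setT)//; apply/seteqP; split.
rewrite [X in measurable X](_ : _ = [set w | X p.1 w = p.2] `&`
  [set w | forall p, p \in l -> X p.1 w = p.2]).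
  by apply: measurableI => //; exact: measurable_state.
apply/seteqP; split=> w /= => [H|[Xp H] r].
  by split=> [|r rl]; apply: H; rewrite inE ?eqxx ?rl ?orbT.
by rewrite inE => /predU1P[->//|]; exact: H.
Qed.

(** Generalising over a prefix of exact observations turns the passage from exact
    states to sets of states into an induction: the first constraint is split
    over its states, each of which extends the prefix. *)
Lemma prob_prefix_visits x (l : seq (R * V)) m :
  path <=%R 0 (unzip1 l) -> all (>= 0) (unzip1 m) ->
  prob x ([set w | forall p, p \in l -> X p.1 w = p.2] `&`
          visits (last 0 (unzip1 l)) m)
  = fdd_weight q x 0 l * visit_prob m (last x (unzip2 l)).
Proof.
elim: m l => [l pl _|[e A] m IH l pl /= /andP[e0 m0]].
  by rewrite setIT fdd//= mulr1.
set t := last 0 _; have t0 : 0 <= t by exact: path_le_last.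
have te0 : 0 <= t + e by rewrite addr_ge0.
set E := (X in prob x X); have mE : measurable E.
  apply: measurableI; last first.
    by apply: measurableI; [exact: measurable_state_in|exact: measurable_visits].
  exact: measurable_fdd.
rewrite (prob_split x te0 mE).
have pl' y : path <=%R 0 (unzip1 (rcons l (t + e, y))).
  by rewrite /unzip1 map_rcons rcons_path pl /= lerDl.
rewrite /semigroup mulr_sumr; apply: eq_bigr => y _.
have [Ay|nAy] := boolP (A y); last first.
  rewrite [X in prob x X](_ : _ = set0); last first.
    apply/seteqP; split=> // w [[_ [/= + _]] Xy].
    by rewrite Xy; apply/negP.
  by rewrite /prob measure0 mul0r !mulr0.
rewrite mul1r mulrA.
have := IH (rcons l (t + e, y)) (pl' y) m0.
rewrite /unzip1 /unzip2 !map_rcons !last_rcons fdd_weight_rcons -/(unzip1 l) -/t.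
rewrite (_ : t + e - t = e) => [<-|]; last by rewrite addrC addKr.
congr (prob x _); apply/seteqP; split=> w.
  move=> [[Xl [_ Vm]] Xy]; split=> //= p.
  by rewrite mem_rcons inE => /predU1P[->//|]; exact: Xl.
move=> [/= Xl Vm]; have Xy := Xl (t + e, y); rewrite mem_rcons mem_head in Xy.
have {}Xy := Xy isT; split=> //; split; last by split=> //=; rewrite Xy.
by move=> p pm; apply: Xl; rewrite mem_rcons inE pm orbT.
Qed.

Lemma visits_gridP delta (A : nat -> pred V) k n w :
  visits (k%:R * delta) [seq (delta, A j) | j <- iota k.+1 n] w <->
  (forall j, (k < j <= k + n)%N -> A j (X (j%:R * delta) w)).
Proof.
elim: n k => [|n IH] k /=.
  by split=> // _ j /andP[kj]; rewrite addn0 leqNgt kj.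
have -> : k%:R * delta + delta = k.+1%:R * delta by rewrite -natr1 mulrDl mul1r.
split=> [[Ak /IH H] j /andP[kj jn]|H].
  move: kj; rewrite leq_eqVlt => /predU1P[<-//|kj].
  by apply: H; rewrite kj addSnnS.
split; first by apply: H; rewrite leqnn addnS ltnS leq_addr.
by apply/IH => j /andP[kj jn]; apply: H; rewrite (ltnW kj) addnS -addSn.
Qed.

Definition grid_event delta (A : nat -> pred V) n : set Omega :=
  [set w | forall j, (j <= n)%N -> A j (X (j%:R * delta) w)].

(** The first gap is 0, so that the first set constrains the starting point; this
    agrees with [stay] because the transition operator at time 0 is the
    identity. *)
Let grid_list delta (A : nat -> pred V) n :=
  (0, A 0%N) :: [seq (delta, A j) | j <- iota 1 n].

Let grid_eventE delta A n : grid_event delta A n = visits 0 (grid_list delta A n).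
Proof.
apply/seteqP; split=> w /=.
  move=> H; split; first by rewrite add0r -[0](mul0r delta); exact: (H 0%N).
  rewrite add0r -[0](mul0r delta); apply/(visits_gridP _ _ 0) => j /andP[_ jn].
  exact: H.
move=> [A0]; rewrite add0r -{1}[0](mul0r delta) => /(visits_gridP _ _ 0) H [|j] jn.
  by move: A0; rewrite add0r mul0r.
exact: H.
Qed.

Let grid_list_ge0 delta A n : 0 <= delta ->
  all (>= 0) (unzip1 (grid_list delta A n)).
Proof.
by move=> d0; rewrite /= lexx /unzip1 -map_comp; apply/allP => _ /mapP[j _ ->].
Qed.

Lemma measurable_grid_event delta A n : 0 <= delta ->
  measurable (grid_event delta A n).
Proof.
move=> d0; rewrite grid_eventE.
by apply: measurable_visits => //; exact: grid_list_ge0.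
Qed.

Lemma prob_grid_event x delta A n : 0 <= delta ->
  prob x (grid_event delta A n) = stay q delta [seq A j | j <- iota 0 n.+1] x.
Proof.
move=> d0; have := @prob_prefix_visits x [::] _ isT (grid_list_ge0 A n d0).
rewrite /= [X in X `&` _](_ : _ = setT); last by apply/seteqP; split.
rewrite setTI mul1r -[X in prob x X]/(visits 0 (grid_list delta A n)) -grid_eventE.
move=> ->; rewrite {1}/semigroup (bigD1 x)//= transition0 eqxx mul1r.
rewrite big1 ?addr0 => [|y /negbTE yx]; last by rewrite transition0 eq_sym yx mul0r.
congr (_ * _); elim: (iota 1 n) x => [|j l IH] x /=.
  by rewrite (semigroup1 transition_sum1).
by apply: eq_bigr => y _; rewrite IH.
Qed.

End GridLaw.

(** * Tail formula for the mean *)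

(** The mean of Y is the area below its graph; [below] is the region under it,
    and exchanging the order of integration slices it horizontally.  Values +oo
    are allowed. *)
Section TailIntegral.
Local Open Scope ereal_scope.
Context d (T : measurableType d) (R : realType) (P : probability T R).
Variable Y : T -> \bar R.
Hypotheses (mY : measurable_fun setT Y) (Y_ge0 : forall w, 0 <= Y w).

Let mu : {measure set (measurableTypeR R) -> \bar R} := @lebesgue_measure R.
Let below : set (T * measurableTypeR R) :=
  [set p | (0 <= p.2)%R /\ p.2%:E < Y p.1].
Let F (p : T * measurableTypeR R) : \bar R := (\1_below p)%:E.

Let measurable_below : measurable below.
Proof.
have -> : below = [set p | (0 <= p.2)%R] `&` [set p | p.2%:E < Y p.1].
  by apply/seteqP; split.
apply: measurableI.
  rewrite [X in measurable X](_ : _ = setT `&` snd @^-1` `[0%R, +oo[%classic).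
    by apply: measurable_snd => //; exact: measurable_itv.
  by apply/seteqP; split=> p /=; rewrite in_itv/= andbT => // -[].
rewrite -[X in measurable X]setTI; apply: measurable_lte => //.
  by apply/measurable_EFinP; exact: measurable_snd.
exact: measurableT_comp mY measurable_fst.
Qed.

Let measurable_F : measurable_fun setT F.
Proof. by apply/measurable_EFinP; exact: measurable_indic. Qed.

Let F_ge0 p : 0 <= F p.
Proof. by rewrite lee_fin. Qed.

Let integral_F_l s : \int[P]_w F (w, s) = P [set w | (0 <= s)%R /\ s%:E < Y w].
Proof.
rewrite (_ : (fun w => F (w, s)) =
  EFin \o \1_[set w | (0 <= s)%R /\ s%:E < Y w]); last first.
  by apply/funext => w.
rewrite integral_indic ?setIT//.
rewrite [X in measurable X](_ : _ = (fun w => (w, s)) @^-1` below)//.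
by rewrite -[X in measurable X]setTI; exact: measurable_pair2.
Qed.

Let integral_F_r w : \int[mu]_s F (w, s) = Y w.
Proof.
rewrite (_ : (fun s => F (w, s)) =
  EFin \o \1_[set s | (0 <= s)%R /\ s%:E < Y w]); last first.
  by apply/funext => s.
case: (Y w) (Y_ge0 w) => [r|_|//].
  rewrite lee_fin => r0; rewrite (_ : [set _ | _] = `[0%R, r[%classic).
    rewrite integral_indic// setIT [LHS](lebesgue_measure_itv `[0%R, r[)/= lte_fin.
    move: r0; rewrite le_eqVlt => /predU1P[<-|r0]; first by rewrite ltxx.
    by rewrite r0 oppr0 adde0.
  by apply/seteqP; split=> s /=; rewrite in_itv/= lte_fin => /andP.
rewrite (_ : [set _ | _] = `[0%R, +oo[%classic).
  by rewrite integral_indic// setIT [LHS](lebesgue_measure_itv `[0%R, +oo[)/= ltry.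
by apply/seteqP; split=> s /=; rewrite in_itv/= andbT ltry => // -[].
Qed.

Lemma measurable_tail : measurable_fun setT
  (fun s : measurableTypeR R => P [set w | (0 <= s)%R /\ s%:E < Y w]).
Proof.
by under eq_fun do rewrite -integral_F_l; exact: measurable_fun_fubini_tonelli_G.
Qed.

Lemma integral_tail :
  \int[P]_w Y w = \int[mu]_s P [set w | (0 <= s)%R /\ s%:E < Y w].
Proof.
under eq_integral do rewrite -integral_F_r.
by rewrite fubini_tonelli//; under eq_integral do rewrite integral_F_l.
Qed.

End TailIntegral.

(** * Avoiding a moving target; the quasistationary distribution *)

Section Avoidance.
Context {R : realType} {V : finType} {d : measure_display}
  {Omega : measurableType d}.
Variables (P : V -> probability Omega R) (X : R -> Omega -> V).
Variables (q : V -> V -> R) (pi : V -> R).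
Hypothesis X_chain : chain_realization P X q.
Hypotheses (pi_gt0 : forall x, 0 < pi x) (pi_sum1 : \sum_x pi x = 1).
Hypothesis q_rev : reversible q pi.
Implicit Types (x y v : V) (s t : R) (h : R -> V).
Local Notation C := (expansion_const q).
Local Notation prob := (prob P).

Definition avoids h t : set Omega :=
  [set w | forall s, 0 <= s <= t -> X s w <> h s].

Let avoid_grid h t n := grid_event X (mesh t n)
  (fun j => predC1 (h (j%:R * mesh t n)) : pred V) (2 ^ n).

Lemma avoidsE h t : cadlag_path h -> 0 <= t ->
  avoids h t = \bigcap_n avoid_grid h t n.
Proof.
move=> ch t0; have cX w : cadlag_path (fun t => X t w) by case: X_chain.
apply/seteqP; split=> w.
  move=> /(cadlag_avoidP (cX w) ch t0) H n _ j jn; exact/eqP/H.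
by move=> H; apply/(cadlag_avoidP (cX w) ch t0) => n j jn; exact/eqP/(H n).
Qed.

Lemma measurable_avoids h t : cadlag_path h -> 0 <= t -> measurable (avoids h t).
Proof.
move=> ch t0; rewrite avoidsE//; apply: bigcapT_measurable => n.
exact: (measurable_grid_event X_chain _ _ (mesh_ge0 n t0)).
Qed.

(** At mesh delta = t / 2^n the grid bound is
    e^{- t lam + C t delta}; let n tend to infinity. *)
Lemma prob_avoids_le lam h t :
  (forall v g, g v = 0 -> lam * dot pi g g <= energy q pi g g) ->
  cadlag_path h -> 0 <= t ->
  prob_from P pi (avoids h t) <= expR (- (t * lam)).
Proof.
move=> lamE ch t0.
pose B n := expR (- (t * lam) + C * (t * mesh t n)).
have Bcvg : B n @[n --> \oo] --> expR (- (t * lam)).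
  have e1 : - (t * lam) + C * (t * mesh t n) @[n --> \oo]
      --> - (t * lam) + C * (t * 0).
    apply: cvgD; first exact: cvg_cst.
    apply: cvgM; first exact: cvg_cst.
    by apply: cvgM; [exact: cvg_cst|exact: mesh_cvg0].
  rewrite !mulr0 addr0 in e1.
  exact: (continuous_cvg _ (@continuous_expR R _) e1).
apply: (@ler_cvg_to _ _ _ _ (fun=> prob_from P pi (avoids h t)) B _ _
  (cvg_cst _) Bcvg).
have := mesh_le1 t; apply: filterS => n m1.
have m0 := mesh_ge0 n t0; have m01 : 0 <= mesh t n <= 1 by rewrite m0.
apply: (@le_trans _ _ (\sum_x pi x * prob x (avoid_grid h t n))).
  apply: ler_sum => x _; rewrite ler_pM2l//.
  apply: prob_le; [exact: measurable_avoids| |].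
    exact: (measurable_grid_event X_chain _ _ m0).
  by rewrite avoidsE// => w; exact.
under eq_bigr => x _ do rewrite (prob_grid_event X_chain _ _ _ m0).
pose hs := [seq h (j%:R * mesh t n) | j <- iota 0 (2 ^ n).+1].
have -> : [seq (predC1 (h (j%:R * mesh t n)) : pred V) | j <- iota 0 (2 ^ n).+1]
    = [seq (predC1 a : pred V) | a <- hs] by rewrite -map_comp.
apply: (le_trans (stay_avoid_le pi_gt0 pi_sum1 q_rev (transition_ge0 X_chain)
  (transition_sum1 X_chain) (transitionD X_chain) lamE m01 _ _)).
rewrite size_map size_iota -expRM_natl.
set N := (2 ^ n)%:R.
have -> : N * (- (mesh t n * lam) + C * mesh t n ^+ 2) =
  - (N * mesh t n * lam) + C * (N * mesh t n * mesh t n) by ring.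
by rewrite mesh_total.
Qed.

Section Quasistationarity.
Variables (v : V) (lam : R) (f : V -> R).
Hypotheses (lam_gt0 : 0 < lam) (f_ge0 : forall x, 0 <= f x) (fv : f v = 0).
Hypothesis fE : forall x, x != v -> generator q f x = lam * f x.

Lemma cadlag_cst : cadlag_path (fun _ : R => v).
Proof.
exists (fun i => i%:R); split=> // [i|]; first by rewrite ltr_nat.
exact: cvgr_idn.
Qed.

Let killed_event (A : pred V) t : set Omega :=
  avoids (fun=> v) t `&` [set w | A (X t w)].

(** The last grid point is time t, where being in [A], which excludes [v],
    replaces avoiding [v]. *)
Let killed_sets (A : pred V) n j : pred V :=
  if (j < 2 ^ n)%N then predC1 v : pred V else A.

Let killed_grid A t n := grid_event X (mesh t n) (killed_sets A n) (2 ^ n).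

Let killed_eventE A t : {subset A <= predC1 v} -> 0 <= t ->
  killed_event A t = \bigcap_n killed_grid A t n.
Proof.
move=> Av t0; rewrite /killed_event (avoidsE cadlag_cst t0).
apply/seteqP; split=> w /=.
  move=> [H At] n _ j jn; rewrite /killed_sets; case: ltnP => jn2; first exact: H.
  by have -> : j = (2 ^ n)%N by [apply/eqP; rewrite eqn_leq jn]; rewrite mesh_total.
move=> H; split=> [n _ j jn|].
  have := H n I j jn; rewrite /killed_sets; case: ifP => // _ Aj.
  exact: (Av _ Aj).
have := H 0%N I 1%N (leqnn _); rewrite /killed_sets expn0 ltnn mul1r /mesh expr0.
by rewrite divr1.
Qed.

(** Dyadic grids are nested: the time j t / 2^n is 2 j t / 2^(n+1). *)
Let killed_grid_nonincreasing A t : {subset A <= predC1 v} ->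
  nonincreasing_seq (killed_grid A t).
Proof.
move=> Av; apply/nonincreasing_seqP => n; apply/subsetPset => w H j jn.
have e2 : (2 ^ n.+1 = 2 ^ n * 2)%N by rewrite expnSr.
have := H (j * 2)%N; rewrite e2 leq_mul2r jn orbT => /(_ isT).
rewrite /killed_sets e2 ltn_mul2r /=.
rewrite (_ : (j * 2)%:R * mesh t n.+1 = j%:R * mesh t n)//.
rewrite /mesh exprS natrM invfM; field; rewrite expf_neq0//.
Qed.

Let prob_killed_grid_cvg A t x : {subset A <= predC1 v} -> 0 <= t ->
  prob x (killed_grid A t n) @[n --> \oo] --> prob x (killed_event A t).
Proof.
move=> Av t0.
have mG n : measurable (killed_grid A t n).
  exact: (measurable_grid_event X_chain _ _ (mesh_ge0 n t0)).
apply: fine_cvg; rewrite -probE; last first.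
  by rewrite killed_eventE//; exact: bigcapT_measurable.
rewrite killed_eventE//; apply: nonincreasing_cvg_mu => //.
- by rewrite ltey_eq fin_num_measure.
- exact: bigcapT_measurable.
- exact: killed_grid_nonincreasing.
Qed.

Let killed_gridE A t n x : 0 <= t -> prob x (killed_grid A t n) =
  stay q (mesh t n) (rcons (nseq (2 ^ n) (predC1 v : pred V)) A) x.
Proof.
move=> t0; rewrite (prob_grid_event X_chain _ _ _ (mesh_ge0 n t0)); congr stay.
rewrite -addn1 iotaD map_cat /= add0n /killed_sets ltnn cats1; congr rcons.
apply: (@eq_from_nth _ (predC1 v : pred V)).
  by rewrite size_map size_iota size_nseq.
move=> i; rewrite size_map size_iota => iN.
by rewrite (nth_map 0%N) ?size_iota// nth_iota// add0n iN nth_nseq iN.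
Qed.

(** Passing to the limit in [stay_eigen]: 2^n steps of error O(delta^2) make an
    error O(t delta). *)
Lemma dot_killed_event A t : {subset A <= predC1 v} -> 0 <= t ->
  dot pi f (fun x => prob x (avoids (fun=> v) t `&` [set w | A (X t w)])) =
  expR (- (lam * t)) * dot pi f (fun x => (A x)%:R).
Proof.
move=> Av t0; set c := RHS; set L := LHS.
have Gcvg : dot pi f (fun x => prob x (killed_grid A t n)) @[n --> \oo] --> L.
  apply: cvg_big => [|x _]; first exact: add_continuous.
  by apply: cvgM; [exact: cvg_cst|exact: prob_killed_grid_cvg].
pose K := eigen_const q lam f.
apply/eqP; rewrite -subr_eq0 -normr_le0.
have Dcvg : `|dot pi f (fun x => prob x (killed_grid A t n)) - c| @[n --> \oo]
    --> `|L - c|.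
  by apply: cvg_norm; apply: cvgB => //; exact: cvg_cst.
have Ecvg : t * K * mesh t n @[n --> \oo] --> 0.
  rewrite -[X in _ --> X](mulr0 (t * K)); apply: cvgM; first exact: cvg_cst.
  exact: mesh_cvg0.
apply: (ler_cvg_to Dcvg Ecvg).
have := mesh_le1 t; apply: filterS => n m1.
have m0 := mesh_ge0 n t0; have m01 : 0 <= mesh t n <= 1 by rewrite m0.
rewrite /= (_ : (fun x => _) =
  stay q (mesh t n) (rcons (nseq (2 ^ n) (predC1 v : pred V)) A)); last first.
  by apply/funext => x; exact: killed_gridE.
have := stay_eigen pi_gt0 pi_sum1 q_rev (transition_ge0 X_chain)
  (transition_sum1 X_chain) (ltW lam_gt0) f_ge0 fv fE m01 (2 ^ n) Av.
rewrite -expRM_natl mulrN mulrCA mesh_total -/c => /le_trans; apply.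
rewrite -/K; set N := (2 ^ n)%:R.
have -> : N * (K * mesh t n ^+ 2) = N * mesh t n * K * mesh t n by ring.
by rewrite mesh_total.
Qed.

(** Right-constancy makes the infimum strict: a path off [v] at time t stays off
    it a little longer. *)
Lemma hitting_time_gt t : 0 <= t ->
  [set w | (t%:E < hitting_time X v w)%E] = avoids (fun=> v) t.
Proof.
move=> t0; have cX w : cadlag_path (fun t => X t w) by case: X_chain.
apply/seteqP; split=> w /=.
  move=> tH s /andP[s0 st] Xs; move: tH; rewrite ltNge => /negP; apply.
  by apply: ge_ereal_inf; exists s%:E; [exists s|rewrite lee_fin].
move=> H; have [e e0 eX] := cadlag_constant_right (cX w) t0.
apply: (@lt_le_trans _ _ (t + e)%:E); first by rewrite lte_fin ltrDl.
apply: le_ereal_inf_tmp => _ [s [s0 Xs] <-]; rewrite lee_fin leNgt.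
apply/negP => ste; have [st|ts] := leP s t; first by apply: (H s); rewrite ?s0.
have := eX s; rewrite (ltW ts) ste => /(_ isT); rewrite Xs => Xt.
by apply: (H t); rewrite ?t0 ?lexx.
Qed.

Lemma measurable_hitting_time : measurable_fun setT (hitting_time X v).
Proof.
apply: (measurability _ (ErealGenOInfty.measurableE R)) => _ [_ [r ->] <-].
rewrite setTI preimage_itvoy; have [r0|r0] := leP 0 r.
  by rewrite hitting_time_gt//; exact: measurable_avoids cadlag_cst _.
rewrite (_ : [set _ | _] = setT)//; apply/seteqP; split=> // w _ /=.
apply: (@lt_le_trans _ _ 0%E); first by rewrite lte_fin.
by apply: le_ereal_inf_tmp => _ [s [s0 _] <-]; rewrite lee_fin.
Qed.

Hypothesis f_unit : dot pi f f = 1.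

(** By reversibility, weighting by pi turns the eigenfunction f of the killed
    generator into an eigenvector of its adjoint, which acts on measures. *)
Definition qsd x : R := pi x * f x / \sum_x pi x * f x.

Let mass_gt0 : 0 < \sum_x pi x * f x.
Proof.
rewrite lt_def sumr_ge0 ?andbT => [|x _]; last by rewrite mulr_ge0// ltW.
apply/eqP => /eqP; rewrite psumr_eq0 => [/allP f0|x _]; last first.
  by rewrite mulr_ge0// ltW.
move: f_unit; rewrite /dot big1 => [/eqP|x _]; first by rewrite eq_sym oner_eq0.
by have /eqP -> := f0 x (mem_index_enum x); rewrite mul0r.
Qed.

Lemma qsd_distribution : is_distribution qsd.
Proof.
split=> [x|]; first by rewrite divr_ge0 ?(ltW mass_gt0)// mulr_ge0// ltW.
by rewrite -mulr_suml divff// gt_eqF.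
Qed.

Let qsd_v : qsd v = 0.
Proof. by rewrite /qsd fv mulr0 mul0r. Qed.

Let sum_qsdE g : \sum_x qsd x * g x = dot pi f g / \sum_x pi x * f x.
Proof. by rewrite mulr_suml; apply: eq_bigr => x _; rewrite mulrAC. Qed.

Lemma prob_qsd_killed A t : {subset A <= predC1 v} -> 0 <= t ->
  prob_from P qsd (avoids (fun=> v) t `&` [set w | A (X t w)]) =
  expR (- (lam * t)) * \sum_x qsd x * (A x)%:R.
Proof.
move=> Av t0; rewrite !sum_qsdE mulrA -dot_killed_event//.
exact: (sum_qsdE (fun x => prob x _)).
Qed.

Lemma prob_qsd_survival t : 0 <= t ->
  prob_from P qsd [set w | (t%:E < hitting_time X v w)%E] = expR (- (lam * t)).
Proof.
move=> t0; rewrite hitting_time_gt//.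
have := @prob_qsd_killed (predC1 v) t (fun _ => id) t0.
rewrite [X in prob_from _ _ X](_ : _ = avoids (fun=> v) t); last first.
  apply/seteqP; split=> w; [by case|move=> H; split=> //=].
  by apply/eqP/H; rewrite t0 lexx.
move=> ->; rewrite -[RHS]mulr1; congr (_ * _).
transitivity (\sum_x qsd x); last by case: qsd_distribution.
apply: eq_bigr => x _ /=; have [->|xv] /= := eqVneq x v; last by rewrite mulr1.
by rewrite qsd_v mul0r.
Qed.

Lemma qsd_quasistationary : quasistationary P X v qsd.
Proof.
split; first exact: qsd_distribution.
move=> t b t0; rewrite prob_qsd_survival// expR_gt0; split=> //.
rewrite hitting_time_gt// setIC; have [->|bv] := eqVneq b v.
  rewrite (_ : _ `&` _ = set0).
    by rewrite /prob_from big1 ?mul0r ?qsd_v// => x _; rewrite measure0 mulr0.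
  apply/seteqP; split=> // w [H /= Xt]; apply: (H t) => //.
  by rewrite t0 lexx.
have Av : {subset pred1 b <= predC1 v} by move=> x; rewrite !inE => /eqP ->.
have := prob_qsd_killed Av t0.
rewrite [X in prob_from _ _ X](_ : _ =
  avoids (fun=> v) t `&` [set w | X t w = b]); last first.
  by apply/seteqP; split=> w [Hw /= /eqP Xb].
move=> ->; rewrite mulrAC divff ?gt_eqF ?expR_gt0// mul1r.
rewrite (bigD1 b)//= eqxx mulr1 big1 ?addr0// => x /negbTE ->.
by rewrite mulr0.
Qed.

(** Under [qsd] the tail of the hitting time is that of the exponential
    distribution of parameter [lam]; multiplying it by [lam] gives a density. *)
Lemma expect_qsd_hitting_time :
  expect_from P qsd (hitting_time X v) = (lam^-1)%:E.
Proof.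
have H_ge0 w : (0 <= hitting_time X v w)%E.
  by apply: le_ereal_inf_tmp => _ [s [s0 _] <-]; rewrite lee_fin.
pose tail x s := P x [set w | 0 <= s /\ (s%:E < hitting_time X v w)%E].
have mtail x : measurable_fun [set: measurableTypeR R] (tail x).
  exact: measurable_tail measurable_hitting_time.
have [qsd_ge0 _] := qsd_distribution.
pose mu : {measure set (measurableTypeR R) -> \bar R} := @lebesgue_measure R.
have termE x : ((qsd x)%:E * \int[P x]_w hitting_time X v w =
    \int[mu]_s ((qsd x)%:E * tail x s))%E.
  rewrite ge0_integralZl_EFin//; congr (_ * _)%E.
  exact: integral_tail measurable_hitting_time H_ge0.
have E1 : (lam%:E * expect_from P qsd (hitting_time X v))%E = 1%E.
  rewrite /expect_from.
  rewrite (eq_bigr _ (fun x _ => termE x)).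
  rewrite -ge0_integral_sum//; last 2 first.
  - by move=> x; exact: measurable_funeM.
  - by move=> x s _; rewrite mule_ge0// lee_fin.
  rewrite -ge0_integralZl_EFin ?(ltW lam_gt0)//; last 2 first.
  - by move=> s _; apply: sume_ge0 => x _; rewrite mule_ge0// lee_fin.
  - by apply: emeasurable_sum => x; exact: measurable_funeM.
  rewrite -(integral_exponential_pdf lam_gt0); apply: eq_integral => s _.
  have [s0|s0] := leP 0 s; last first.
    rewrite lt0_exponential_pdf// big1 ?mule0// => x _.
    rewrite /tail (_ : [set _ | _] = set0) ?measure0 ?mule0//.
    by apply/seteqP; split=> // w []; rewrite leNgt s0.
  rewrite exponential_pdfE//; under eq_bigr => x _.
    rewrite /tail (_ : [set w | _] =
      [set w | (s%:E < hitting_time X v w)%E]); last first.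
      by apply/seteqP; split=> // w [].
    rewrite probE ?hitting_time_gt//; last exact: measurable_avoids cadlag_cst _.
    over.
  rewrite /= sumEFin -EFinM mulNr; congr ((_ * _)%:E).
  by rewrite -prob_qsd_survival// hitting_time_gt.
case: expect_from E1 => [r||].
- rewrite -EFinM => -[lr]; congr (_%:E).
  by apply: (@mulfI _ lam); rewrite ?gt_eqF// lr divff ?gt_eqF.
- by rewrite gt0_muley ?lte_fin.
- by rewrite gt0_muleNy ?lte_fin.
Qed.

End Quasistationarity.
End Avoidance.

(** * The best fixed target *)

(** Detailed balance makes the support of pi closed under the edges of the chain,
    so irreducibility forces it to be everything. *)
Lemma reversible_gt0 {R : realType} {V : finType} (q : V -> V -> R) (pi : V -> R) :
  is_distribution pi -> reversible q pi -> irreducible_rates q ->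
  forall x, 0 < pi x.
Proof.
move=> [pi0 pi1] q_rev q_irr x; pose A := [set x | pi x != 0]%SET.
have A0 : A != finset.set0.
  apply/eqP => A0; move: pi1; rewrite big1 => [/eqP|y _].
    by rewrite eq_sym oner_eq0.
  have : y \notin A by rewrite A0 finset.in_set0.
  by rewrite inE negbK => /eqP.
have [C0|/(q_irr A A0)[a [b [aA bA qab]]]] := eqVneq (~: A)%SET finset.set0.
  have : x \notin (~: A)%SET by rewrite C0 finset.in_set0.
  by rewrite !inE negbK lt_def pi0 andbT.
move: aA bA; rewrite !inE negbK => a0 /eqP b0.
have := reversibleT q_rev a b; rewrite b0 mul0r => /eqP.
by rewrite mulf_eq0 (negbTE a0) (negbTE qab).
Qed.

Theorem lemma1p1 (R : realType) (V : finType) (q : V -> V -> R) (pi : V -> R)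
    (d : measure_display) (Omega : measurableType d)
    (P : V -> probability Omega R) (X : R -> Omega -> V)
    (V_ge2 : (2 <= #|V|)%N)
    (q_ge0 : forall x y, x != y -> 0 <= q x y)
    (q_irr : irreducible_rates q)
    (pi_stat : stationary_distribution q pi)
    (q_rev : reversible q pi)
    (X_chain : chain_realization P X q) :
  exists (v : V) (qv : V -> R),
    [/\ quasistationary P X v qv,
        (0 < expect_from P qv (hitting_time X v) < +oo)%E &
        forall h : R -> V, cadlag_path h -> forall t : R, 0 <= t ->
          prob_from P pi [set w | forall s, 0 <= s <= t -> X s w <> h s]
            <= prob_from P qv [set w | (t%:E < hitting_time X v w)%E] /\
          prob_from P qv [set w | (t%:E < hitting_time X v w)%E]
            = expR (- (t / fine (expect_from P qv (hitting_time X v))))].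
Proof.
have [pi_distr _] := pi_stat; have [_ pi_sum1] := pi_distr.
have pi_gt0 := reversible_gt0 pi_distr q_rev q_irr.
(* The two existentials are merged into one over pairs, for choice. *)
have [gs gsP] := choice (fun v => let: ex_intro lam (ex_intro f H) :=
  ground_state_exists pi_gt0 q_rev q_ge0 q_irr V_ge2 v in
  ex_intro (fun p => ground_state q pi v p.1 p.2) (lam, f) H).
have [v0 _] : exists v0 : V, v0 \in V by apply/card_gt0P; exact: ltnW V_ge2.
pose v := [arg min_(v < v0) (gs v).1]%O.
have vmin u : (gs v).1 <= (gs u).1.
  by rewrite /v; case: arg_minP => // w _ wmin; exact: wmin.
have [lam_gt0 [f_ge0 fv] f_unit fE _] := gsP v.
(* The constant of v is the smallest, so it serves in the Poincare inequality of
   every state, which is what a moving target needs. *)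
have lamE u g : g u = 0 -> (gs v).1 * dot pi g g <= energy q pi g g.
  move=> gu; have [_ _ _ _ /(_ g gu)] := gsP u; apply: le_trans.
  by rewrite ler_wpM2r// dotff_ge0.
have EH := expect_qsd_hitting_time X_chain pi_gt0 pi_sum1 q_rev lam_gt0 f_ge0 fv
  fE f_unit.
exists v, (qsd pi (gs v).2); split.
- exact: qsd_quasistationary fE f_unit.
- by rewrite EH lte_fin invr_gt0 lam_gt0 ltry.
- move=> h ch t t0; rewrite EH /= invrK [t * _]mulrC.
  have S := prob_qsd_survival X_chain pi_gt0 pi_sum1 q_rev lam_gt0 f_ge0 fv
    fE f_unit t0.
  split; rewrite S// [_ * t]mulrC.
  exact: prob_avoids_le lamE ch t0.
Qed.
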